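(* Let $w\in\mathbb{C}$ with $|w|=1$, let $m\in\mathbb{N}$, let $\varphi$ be an analytic self-map of $\mathbb{D}$ with $\varphi(0)=0$, and let $\psi\in H(\mathbb{D})$ be not identically zero, such that $D_{m,\psi,\varphi}$ is bounded and $J_w$-symmetric on $H^2(\beta)$. Then $D_{m,\psi,\varphi}$ is normal.
   Context: $\mathbb{N}=\{0,1,2,\dots\}$. $\mathbb{D}$ is the open unit disc in $\mathbb{C}$ and $H(\mathbb{D})$ is the space of analytic functions on $\mathbb{D}$. $\{\beta(n)\}_{n\ge 0}$ is a sequence of positive numbers with $\beta(0)=1$ and $\liminf_{n}\beta(n)^{1/n}\ge 1$. The weighted Hardy space $H^2(\beta)$ is the Hilbert space of all $f(z)=\sum_{n\ge0}a_nz^n\in H(\mathbb{D})$ with $\|f\|^2=\sum_{n\ge 0}|a_n|^2\beta(n)^2<\infty$, with inner product $\langle f,g\rangle=\sum_{n\ge 0}a_n\overline{c_n}\beta(n)^2$ for $g(z)=\sum_{n\ge 0}c_nz^n$. For $m\in\mathbb{N}$, $\psi\in H(\mathbb{D})$ and an analytic self-map $\varphi$ of $\mathbb{D}$, the generalized weighted composition operator is $D_{m,\psi,\varphi}f(z)=\psi(z)f^{(m)}(\varphi(z))$. For $w\in\mathbb{C}$ with $|w|=1$, the conjugation $J_w$ on $H^2(\beta)$ (conjugate-linear, isometric, $J_w^2=I$) is $J_wf(z)=\overline{f(w\bar z)}$. A bounded linear operator $T$ on $H^2(\beta)$ is $J_w$-symmetric if $T=J_wT^*J_w$, and normal if $TT^*=T^*T$.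 *)

(* Defs.v *)
(* Stdlib reals with Coquelicot.

   Elements of H^2(beta) are represented by total functions f : C -> C of which
   only the restriction to the open unit disc matters; accordingly, two such
   functions are compared pointwise on the disc. *)
From Stdlib Require Import Reals ClassicalEpsilon.
From Coquelicot Require Import Coquelicot.

Local Open Scope R_scope.

Definition unit_disc (z : C) : Prop := Cmod z < 1.

(* f is in H(D): complex differentiable at every point of the disc. *)
Definition analytic_on_disc (f : C -> C) : Prop :=
  forall z : C, unit_disc z -> ex_derive (K := C_AbsRing) (V := C_NormedModule) f z.

Definition analytic_self_map (phi : C -> C) : Prop :=
  analytic_on_disc phi /\ forall z : C, unit_disc z -> unit_disc (phi z).

(* The value of [Rpower (beta 0) (/ INR 0)] is irrelevant to the liminf. *)
Definition weight_sequence (beta : nat -> R) : Prop :=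
  (forall n : nat, 0 < beta n) /\
  beta 0%nat = 1 /\
  Rbar_le 1 (LimInf_seq (fun n : nat => Rpower (beta n) (/ INR n))).

Definition expands_on_disc (f : C -> C) (a : nat -> C) : Prop :=
  forall z : C, unit_disc z ->
    is_pseries (K := C_AbsRing) (V := C_NormedModule) a z (f z).

(* The (unique) sequence a with f(z) = sum_n a_n z^n on the disc; unspecified
   when f has no such expansion. *)
Definition taylor (f : C -> C) : nat -> C :=
  epsilon (inhabits (fun _ : nat => RtoC 0)) (expands_on_disc f).

(* The second conjunct follows from the first by Taylor's theorem; it is kept as
   part of the description "f(z) = sum_n a_n z^n in H(D)". *)
Definition in_H2 (beta : nat -> R) (f : C -> C) : Prop :=
  analytic_on_disc f /\
  expands_on_disc f (taylor f) /\
  ex_series (fun n : nat => (Cmod (taylor f n))^2 * (beta n)^2).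

(* Coquelicot's [Series] is real-valued, so a complex series is summed
   componentwise. *)
Definition C_Series (u : nat -> C) : C :=
  (Series (fun n : nat => Re (u n)), Series (fun n : nat => Im (u n))).

Definition H2_inner (beta : nat -> R) (f g : C -> C) : C :=
  C_Series (fun n : nat =>
    (taylor f n * Cconj (taylor g n) * RtoC ((beta n)^2))%C).

Definition H2_norm (beta : nat -> R) (f : C -> C) : R :=
  sqrt (Series (fun n : nat => (Cmod (taylor f n))^2 * (beta n)^2)).

Definition gen_wcomp (m : nat) (psi phi : C -> C) (f : C -> C) : C -> C :=
  fun z : C => (psi z * Nat.iter m C_derive f (phi z))%C.

Definition Jw (w : C) (f : C -> C) : C -> C :=
  fun z : C => Cconj (f (w * Cconj z)%C).

(* T acts boundedly on H^2(beta); linearity is not part of this predicate, as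
   [gen_wcomp m psi phi] is linear on analytic functions by construction. *)
Definition bounded_on_H2 (beta : nat -> R) (T : (C -> C) -> (C -> C)) : Prop :=
  (forall f : C -> C, in_H2 beta f -> in_H2 beta (T f)) /\
  exists M : R, forall f : C -> C, in_H2 beta f ->
    H2_norm beta (T f) <= M * H2_norm beta f.

(* S is the Hilbert space adjoint of T.  Testing against the monomials shows
   that S g is determined on the disc by T and g. *)
Definition is_adjoint (beta : nat -> R) (T S : (C -> C) -> (C -> C)) : Prop :=
  (forall g : C -> C, in_H2 beta g -> in_H2 beta (S g)) /\
  (forall f g : C -> C, in_H2 beta f -> in_H2 beta g ->
     H2_inner beta (T f) g = H2_inner beta f (S g)).

(* In the next two definitions the adjoint S exists as soon as T is bounded (and
   linear), and it is unique as an operator on H^2(beta). *)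
Definition J_symmetric (beta : nat -> R) (w : C) (T : (C -> C) -> (C -> C)) : Prop :=
  exists S : (C -> C) -> (C -> C),
    is_adjoint beta T S /\
    forall f : C -> C, in_H2 beta f ->
      forall z : C, unit_disc z -> T f z = Jw w (S (Jw w f)) z.

Definition normal_on_H2 (beta : nat -> R) (T : (C -> C) -> (C -> C)) : Prop :=
  exists S : (C -> C) -> (C -> C),
    is_adjoint beta T S /\
    forall f : C -> C, in_H2 beta f ->
      forall z : C, unit_disc z -> T (S f) z = S (T f) z.

(* Main.v *)
(* Let t(k,n) be the k-th coefficient of T z^n, where T = D_{m,psi,phi}.  J_w acts
   diagonally on the monomials, so J_w-symmetry gives t(k,n) = 0 as soon as
   t(n,k) = 0.  Since T z^n is a multiple of psi * phi^(n-m), it vanishes for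
   n < m; by symmetry the first m coefficients of T z^m, hence those of psi,
   vanish.  As phi(0) = 0, T z^n then has a zero of order at least n at the
   origin: t is triangular, hence by symmetry diagonal, and a diagonal operator
   commutes with its adjoint.

   Cauchy's theorem is not needed: membership of psi * phi^(n-m) in H^2(beta)
   already provides its power series, and the orders of vanishing are read off
   from growth estimates along the real axis. *)
Require Import Defs.
From Stdlib Require Import Reals ClassicalEpsilon Lra Lia.
From Coquelicot Require Import Coquelicot.

Local Open Scope R_scope.

(** * Complex series through their real and imaginary parts *)

(** Partial sums commute with [Re] and [Im], and balls of [C_NormedModule] are products of real
    balls, so convergence can be tested componentwise. *)
Lemma is_series_C (u : nat -> C) (l : C) :
  is_series (K := C_AbsRing) (V := C_NormedModule) u l <->
  is_series (fun n => Re (u n)) (Re l) /\ is_series (fun n => Im (u n)) (Im l).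
Proof.
  assert (Hre : forall n, sum_n (fun k => Re (u k)) n = Re (sum_n (G := C_NormedModule) u n)).
  { induction n as [|n IH]; [now rewrite !sum_O | now rewrite !sum_Sn, IH]. }
  assert (Him : forall n, sum_n (fun k => Im (u k)) n = Im (sum_n (G := C_NormedModule) u n)).
  { induction n as [|n IH]; [now rewrite !sum_O | now rewrite !sum_Sn, IH]. }
  unfold is_series; split.
  - intros H; split; apply filterlim_locally; intros eps;
      generalize (proj1 (filterlim_locally _ _) H eps); apply filter_imp;
      intros n [H1 H2]; [rewrite Hre | rewrite Him]; assumption.
  - intros [H1 H2]; apply filterlim_locally; intros eps.
    generalize (filter_and _ _ (proj1 (filterlim_locally _ _) H1 eps)
                  (proj1 (filterlim_locally _ _) H2 eps)).
    apply filter_imp; intros n [K1 K2]; rewrite Hre in K1; rewrite Him in K2.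
    split; assumption.
Qed.

(** The partial sums vanish before index [n] and equal [u n] from there on. *)
Lemma is_series_single (u : nat -> R) (n : nat) :
  (forall k, k <> n -> u k = 0) -> is_series u (u n).
Proof.
  intros Hu.
  assert (Hs : forall N, sum_n u N = if Compare_dec.le_dec n N then u n else 0).
  { induction N as [|N IH].
    - rewrite sum_O; destruct (Compare_dec.le_dec n 0) as [H|H]; [f_equal; lia | apply Hu; lia].
    - rewrite sum_Sn, IH; unfold plus; simpl.
      destruct (Compare_dec.le_dec n N), (Compare_dec.le_dec n (S N)); try lia.
      + rewrite (Hu (S N)) by lia; ring.
      + replace (S N) with n by lia; ring.
      + rewrite (Hu (S N)) by lia; ring. }
  apply (filterlim_ext_loc (fun _ => u n)); [| apply filterlim_const].
  exists n; intros N HN; rewrite Hs; destruct (Compare_dec.le_dec n N); [easy | lia].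
Qed.

Lemma C_Series_single (u : nat -> C) (n : nat) :
  (forall k, k <> n -> u k = RtoC 0) -> C_Series u = u n.
Proof.
  intros Hu; unfold C_Series.
  rewrite (is_series_unique _ (Re (u n))), (is_series_unique _ (Im (u n))).
  - now destruct (u n).
  - apply (is_series_single (fun k => Im (u k))); intros k Hk; now rewrite Hu.
  - apply (is_series_single (fun k => Re (u k))); intros k Hk; now rewrite Hu.
Qed.

(** * Power series on the disc and their coefficients *)

Lemma expands_on_disc_series (f : C -> C) (a : nat -> C) :
  expands_on_disc f a <->
  forall z, unit_disc z ->
    is_series (fun k => Re (Cpow z k * a k)%C) (Re (f z)) /\
    is_series (fun k => Im (Cpow z k * a k)%C) (Im (f z)).
Proof.
  unfold expands_on_disc, is_pseries.
  split; intros H z Hz; specialize (H z Hz).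
  - apply (is_series_C (fun k => Cpow z k * a k)%C).
    apply (is_series_ext (K := C_AbsRing) (V := C_NormedModule)) with (2 := H).
    intros n; reflexivity.
  - apply (is_series_C (fun k => Cpow z k * a k)%C) in H.
    apply (is_series_ext (K := C_AbsRing) (V := C_NormedModule)) with (2 := H).
    intros n; reflexivity.
Qed.

Lemma unit_disc_real (x : R) : Rabs x < 1 -> unit_disc (RtoC x).
Proof. unfold unit_disc; now rewrite Cmod_R. Qed.

(** At a real point the powers of [x] are real, so the expansion splits into two real power series;
    this opens the way to the theory of [PSeries]. *)
Lemma expands_on_disc_real (f : C -> C) (a : nat -> C) (x : R) :
  expands_on_disc f a -> Rabs x < 1 ->
  is_pseries (fun k => Re (a k)) x (Re (f (RtoC x))) /\
  is_pseries (fun k => Im (a k)) x (Im (f (RtoC x))).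
Proof.
  intros H Hx.
  destruct (proj1 (expands_on_disc_series f a) H _ (unit_disc_real x Hx)) as [H1 H2].
  split.
  - apply is_series_ext with (2 := H1); intros n.
    rewrite <- RtoC_pow; change (Re (RtoC (x ^ n) * a n)%C = x ^ n * Re (a n)); unfold Re; simpl; ring.
  - apply is_series_ext with (2 := H2); intros n.
    rewrite <- RtoC_pow; change (Im (RtoC (x ^ n) * a n)%C = x ^ n * Im (a n)); unfold Im; simpl; ring.
Qed.

(** Beyond the radius the terms cannot tend to 0, whereas convergence at [x] makes them do so; hence
    [x] is at most the radius. *)
Lemma CV_radius_gt_0 (c : nat -> R) (x : R) :
  0 < x -> ex_pseries c x -> Rbar_lt 0 (CV_radius c).
Proof.
  intros Hx Hc.
  apply Rbar_lt_le_trans with x; [exact Hx |].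
  apply Rbar_not_lt_le; intros H.
  apply (CV_disk_outside c x).
  - rewrite Rabs_pos_eq by lra; exact H.
  - apply ex_series_lim_0.
    destruct Hc as [l Hl]; exists l.
    apply is_series_ext with (2 := Hl); intros n.
    change (x ^ n * c n = c n * x ^ n); ring.
Qed.

Lemma expands_on_disc_CV_radius (f : C -> C) (a : nat -> C) :
  expands_on_disc f a ->
  Rbar_lt 0 (CV_radius (fun k => Re (a k))) /\
  Rbar_lt 0 (CV_radius (fun k => Im (a k))).
Proof.
  intros H.
  (* Any point of (0,1) would serve in place of 1/2. *)
  destruct (expands_on_disc_real f a (/ 2) H) as [H1 H2];
    [rewrite Rabs_pos_eq; lra |].
  split; apply CV_radius_gt_0 with (/ 2); try lra; eexists; eassumption.
Qed.

(** Positive radii and agreement on the real interval (-1,1) determine the real and imaginary parts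
    of the coefficients. *)
Lemma expands_on_disc_unique (f g : C -> C) (a b : nat -> C) :
  expands_on_disc f a -> expands_on_disc g b ->
  (forall z, unit_disc z -> f z = g z) -> forall k, a k = b k.
Proof.
  intros Hf Hg E k.
  destruct (expands_on_disc_CV_radius f a Hf) as [F1 F2].
  destruct (expands_on_disc_CV_radius g b Hg) as [G1 G2].
  assert (Hx : forall x, Rabs (x - 0) < 1 ->
    PSeries (fun k => Re (a k)) x = PSeries (fun k => Re (b k)) x /\
    PSeries (fun k => Im (a k)) x = PSeries (fun k => Im (b k)) x).
  { intros x Hx; rewrite Rminus_0_r in Hx.
    destruct (expands_on_disc_real f a x Hf Hx) as [A1 A2].
    destruct (expands_on_disc_real g b x Hg Hx) as [B1 B2].
    rewrite (E _ (unit_disc_real x Hx)) in A1, A2.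
    split; etransitivity.
    1, 3: apply is_pseries_unique; eassumption.
    all: symmetry; apply is_pseries_unique; assumption. }
  apply injective_projections.
  - apply (PSeries_ext_recip (fun k => Re (a k)) (fun k => Re (b k))); try assumption.
    exists (mkposreal 1 Rlt_0_1); intros x H; apply Hx, H.
  - apply (PSeries_ext_recip (fun k => Im (a k)) (fun k => Im (b k))); try assumption.
    exists (mkposreal 1 Rlt_0_1); intros x H; apply Hx, H.
Qed.

(** [epsilon] returns an expansion of [f] once one exists, and uniqueness identifies it with [a]. *)
Lemma taylor_unique (f : C -> C) (a : nat -> C) :
  expands_on_disc f a -> forall k, taylor f k = a k.
Proof.
  intros H; apply (expands_on_disc_unique f f); try easy.
  unfold taylor; apply epsilon_spec; now exists a.
Qed.

Lemma expands_on_disc_eq (f g : C -> C) (a b : nat -> C) :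
  expands_on_disc f a -> expands_on_disc g b ->
  (forall k, a k = b k) -> forall z, unit_disc z -> f z = g z.
Proof.
  intros Hf Hg E z Hz.
  apply (filterlim_locally_unique (F := eventually)
           (sum_n (G := C_NormedModule) (fun k => scal (pow_n (K := C_AbsRing) z k) (a k)))).
  - apply (Hf z Hz).
  - apply (is_series_ext (K := C_AbsRing) (V := C_NormedModule)) with (2 := Hg z Hz).
    intros k; now rewrite E.
Qed.

(** * Orders of vanishing at the origin *)

(** When the first [n] coefficients vanish, this function is the quotient of the series by x^n.
    Dropping one coefficient at a time preserves the radius of convergence. *)
Lemma PS_decr_n_continuity (c : nat -> R) (n : nat) :
  Rbar_lt 0 (CV_radius c) -> continuity_pt (PSeries (PS_decr_n c n)) 0.
Proof.
  intros Hc; apply PSeries_continuity; rewrite Rabs_R0.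
  induction n as [|n IH].
  - rewrite (CV_radius_ext _ c); [exact Hc | intros k; reflexivity].
  - rewrite (CV_radius_ext _ (PS_decr_1 (PS_decr_n c n))).
    + now rewrite CV_radius_decr_1.
    + intros k; unfold PS_decr_1, PS_decr_n; f_equal; lia.
Qed.

Lemma PSeries_0 (c : nat -> R) : PSeries c 0 = c 0%nat.
Proof.
  rewrite (PSeries_decr_n c 0).
  - simpl; ring.
  - exists (c 0%nat); apply (is_pseries_0 (K := R_AbsRing) (V := R_NormedModule)).
Qed.

(** The series is x^n times a function continuous at 0, which near 0 is bounded by its modulus at 0
    plus 1. *)
Lemma PSeries_ge_order (c : nat -> R) (n : nat) :
  Rbar_lt 0 (CV_radius c) ->
  (forall k, (k < n)%nat -> c k = 0) ->
  exists (d M : R), 0 < d /\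
    forall x, Rabs x < d -> Rabs (PSeries c x) <= M * Rabs x ^ n.
Proof.
  intros Hc H0.
  generalize (PS_decr_n_continuity c n Hc); intros Hcont.
  apply continuity_pt_locally with (eps := mkposreal 1 Rlt_0_1) in Hcont.
  destruct Hcont as [d Hd].
  exists d, (Rabs (PSeries (PS_decr_n c n) 0) + 1); split; [apply cond_pos |].
  intros x Hx.
  rewrite (PSeries_decr_n_aux c n x H0), Rabs_mult, <- RPow_abs, Rmult_comm.
  apply Rmult_le_compat_r; [apply pow_le, Rabs_pos |].
  assert (Hb : ball 0 d x).
  { change (Rabs (x - 0) < d); now rewrite Rminus_0_r. }
  specialize (Hd x Hb); simpl in Hd.
  generalize (Rabs_triang_inv (PSeries (PS_decr_n c n) x) (PSeries (PS_decr_n c n) 0)); lra.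
Qed.

(** Strong induction: if [c k] is the first nonzero coefficient and k < n, dividing by x^k leaves a
    function g with g(0) = [c k], yet the growth bound forces g(x) = O(x). *)
Lemma PSeries_order_ge (c : nat -> R) (n : nat) (d M : R) :
  Rbar_lt 0 (CV_radius c) -> 0 < d ->
  (forall x, Rabs x < d -> Rabs (PSeries c x) <= M * Rabs x ^ n) ->
  forall k, (k < n)%nat -> c k = 0.
Proof.
  intros Hc Hd H k.
  induction k as [k IH] using (well_founded_induction Wf_nat.lt_wf); intros Hk.
  destruct (Req_dec (c k) 0) as [E|E]; [exact E | exfalso].
  set (g := PSeries (PS_decr_n c k)).
  assert (Hg0 : g 0 = c k).
  { unfold g; rewrite PSeries_0; unfold PS_decr_n; f_equal; lia. }
  assert (Hpos : 0 < Rabs (c k)) by now apply Rabs_pos_lt.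
  assert (Hcont : continuity_pt g 0) by now apply PS_decr_n_continuity.
  assert (Heps : 0 < Rabs (c k) / 2) by lra.
  apply continuity_pt_locally with (eps := mkposreal _ Heps) in Hcont.
  destruct Hcont as [e He].
  assert (HM : 0 < Rabs M + 1) by (generalize (Rabs_pos M); lra).
  (* For x < [q] the bound (|M| + 1) x stays below |c k| / 2; |M| + 1 replaces [M] to have a
     positive divisor. *)
  set (q := Rabs (c k) / 2 / (Rabs M + 1)).
  assert (Hq : 0 < q) by now apply Rdiv_lt_0_compat.
  (* [x] is below [e] for continuity, [d] for the growth bound, 1 for x^(n-k-1) <= 1 and [q] for the
     contradiction. *)
  set (x := Rmin (Rmin e d) (Rmin 1 q) / 2).
  generalize (cond_pos e); intros Hepos.
  assert (Hx : 0 < x /\ x < e /\ x < d /\ x < 1 /\ x < q).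
  { unfold x, Rmin; destruct (Rle_dec e d), (Rle_dec 1 q);
      destruct (Rle_dec _ _); lra. }
  destruct Hx as (X0 & Xe & Xd & X1 & Xq).
  assert (Ax : Rabs x = x) by (apply Rabs_pos_eq; lra).
  assert (Hb : ball 0 e x).
  { change (Rabs (x - 0) < e); now rewrite Rminus_0_r, Ax. }
  specialize (He x Hb); simpl in He; rewrite Hg0 in He.
  assert (Hlow : Rabs (c k) / 2 < Rabs (g x)).
  { generalize (Rabs_triang_inv (c k) (g x)); rewrite Rabs_minus_sym; lra. }
  specialize (H x ltac:(lra)).
  rewrite (PSeries_decr_n_aux c k x) in H by (intros j Hj; apply IH; lia).
  fold g in H; rewrite Rabs_mult, <- RPow_abs, Ax in H.
  (* As k < n, one factor x survives the cancellation of x^k. *)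
  replace n with (k + S (n - S k))%nat in H by lia.
  rewrite pow_add in H; simpl in H.
  assert (Hxk : 0 < x ^ k) by now apply pow_lt.
  assert (H1 : Rabs (g x) <= M * (x * x ^ (n - S k))).
  { apply Rmult_le_reg_l with (x ^ k); [exact Hxk | lra]. }
  assert (H2 : x ^ (n - S k) <= 1).
  { rewrite <- (pow1 (n - S k)); apply pow_incr; lra. }
  assert (H3 : 0 < x ^ (n - S k)) by now apply pow_lt.
  assert (H4 : M * (x * x ^ (n - S k)) <= (Rabs M + 1) * x).
  { generalize (Rle_abs M); intros HMM.
    apply Rle_trans with ((Rabs M + 1) * (x * x ^ (n - S k))).
    - apply Rmult_le_compat_r; [apply Rmult_le_pos |]; lra.
    - apply Rmult_le_compat_l; [lra |].
      apply Rle_trans with (x * 1); [apply Rmult_le_compat_l |]; lra. }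
  assert (H5 : (Rabs M + 1) * x < Rabs (c k) / 2).
  { replace (Rabs (c k) / 2) with ((Rabs M + 1) * q) by (unfold q; field; lra).
    now apply Rmult_lt_compat_l. }
  lra.
Qed.

(* Only real points are tested: a power series is determined by its values there. *)
Definition order_ge (n : nat) (f : C -> C) : Prop :=
  exists (d M : R), 0 < d /\
    forall x : R, Rabs x < d -> Cmod (f (RtoC x)) <= M * Rabs x ^ n.

Lemma order_ge_taylor (f : C -> C) (a : nat -> C) (n : nat) :
  expands_on_disc f a -> order_ge n f -> forall k, (k < n)%nat -> a k = RtoC 0.
Proof.
  intros Hf (d & M & Hd & H) k Hk.
  destruct (expands_on_disc_CV_radius f a Hf) as [F1 F2].
  (* The expansion holds only inside the disc, so the interval is cut down to radius at most 1. *)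
  assert (Hd' : 0 < Rmin d 1) by (apply Rmin_glb_lt; lra).
  assert (K : forall x, Rabs x < Rmin d 1 -> Rabs x < d /\ Rabs x < 1).
  { intros x Hx; split; apply Rlt_le_trans with (1 := Hx);
      [apply Rmin_l | apply Rmin_r]. }
  apply injective_projections; simpl.
  - apply (PSeries_order_ge (fun k => Re (a k)) n (Rmin d 1) M); try assumption.
    intros x Hx; destruct (K x Hx) as [Kd K1].
    rewrite (is_pseries_unique _ _ _ (proj1 (expands_on_disc_real f a x Hf K1))).
    eapply Rle_trans; [apply re_le_Cmod | now apply H].
  - apply (PSeries_order_ge (fun k => Im (a k)) n (Rmin d 1) M); try assumption.
    intros x Hx; destruct (K x Hx) as [Kd K1].
    rewrite (is_pseries_unique _ _ _ (proj2 (expands_on_disc_real f a x Hf K1))).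
    eapply Rle_trans; [| now apply H].
    eapply Rle_trans; [apply Rmax_r | apply Rmax_Cmod].
Qed.

(** The bounds for the real and imaginary parts add up, the modulus being at most |Re| + |Im|. *)
Lemma taylor_order_ge (f : C -> C) (a : nat -> C) (n : nat) :
  expands_on_disc f a -> (forall k, (k < n)%nat -> a k = RtoC 0) -> order_ge n f.
Proof.
  intros Hf H0.
  destruct (expands_on_disc_CV_radius f a Hf) as [F1 F2].
  destruct (PSeries_ge_order (fun k => Re (a k)) n F1) as (d1 & M1 & D1 & B1).
  { intros k Hk; now rewrite (H0 k Hk). }
  destruct (PSeries_ge_order (fun k => Im (a k)) n F2) as (d2 & M2 & D2 & B2).
  { intros k Hk; now rewrite (H0 k Hk). }
  exists (Rmin 1 (Rmin d1 d2)), (M1 + M2).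
  split; [repeat apply Rmin_glb_lt; lra |].
  intros x Hx.
  assert (K : Rabs x < 1 /\ Rabs x < d1 /\ Rabs x < d2).
  { revert Hx; unfold Rmin; destruct (Rle_dec d1 d2);
      destruct (Rle_dec _ _); lra. }
  destruct K as (K1 & Kd1 & Kd2).
  destruct (expands_on_disc_real f a x Hf K1) as [A1 A2].
  specialize (B1 x Kd1); specialize (B2 x Kd2).
  rewrite (is_pseries_unique _ _ _ A1) in B1.
  rewrite (is_pseries_unique _ _ _ A2) in B2.
  apply Rle_trans with (Rabs (Re (f x)) + Rabs (Im (f x))); [| lra].
  replace (f x) with (Re (f x) + Ci * Im (f x))%C at 1.
  - eapply Rle_trans; [apply Cmod_triangle |].
    rewrite Cmod_mult, !Cmod_R, Cmod_Ci; lra.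
  - unfold Re, Im; apply injective_projections; simpl; ring.
Qed.

Lemma order_ge_mult (n p : nat) (f g : C -> C) :
  order_ge n f -> order_ge p g -> order_ge (n + p) (fun z => f z * g z)%C.
Proof.
  intros (d1 & M1 & D1 & B1) (d2 & M2 & D2 & B2).
  exists (Rmin d1 d2), (M1 * M2); split; [now apply Rmin_glb_lt |].
  intros x Hx.
  specialize (B1 x (Rlt_le_trans _ _ _ Hx (Rmin_l _ _))).
  specialize (B2 x (Rlt_le_trans _ _ _ Hx (Rmin_r _ _))).
  rewrite Cmod_mult, pow_add.
  replace (M1 * M2 * (Rabs x ^ n * Rabs x ^ p))
    with (M1 * Rabs x ^ n * (M2 * Rabs x ^ p)) by ring.
  apply Rmult_le_compat; auto using Cmod_ge_0.
Qed.

Lemma order_ge_const (c : C) : order_ge 0 (fun _ => c).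
Proof.
  exists 1, (Cmod c); split; [lra | intros x _; simpl; lra].
Qed.

Lemma order_ge_pow (f : C -> C) (n : nat) :
  order_ge 1 f -> order_ge n (fun z => Cpow (f z) n).
Proof.
  intros Hf; induction n as [|n IH].
  - exact (order_ge_const (RtoC 1)).
  - exact (order_ge_mult 1 n f _ Hf IH).
Qed.

(** Differentiability at 0 with tolerance 1 gives |phi(x) - x l| <= |x| near 0, hence the constant
    |l| + 1. *)
Lemma order_ge_fixed_0 (phi : C -> C) :
  analytic_on_disc phi -> phi (RtoC 0) = RtoC 0 -> order_ge 1 phi.
Proof.
  intros Ha H0.
  destruct (Ha (RtoC 0)) as [l [_ Hl]]; [unfold unit_disc; rewrite Cmod_0; lra |].
  specialize (Hl (RtoC 0) (fun P H => H) (mkposreal 1 Rlt_0_1)).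
  destruct Hl as [d Hd].
  exists d, (Cmod l + 1); split; [apply cond_pos |].
  intros x Hx.
  assert (Hb : ball (M := AbsRing_UniformSpace C_AbsRing) (RtoC 0) d (RtoC x)).
  { change (Cmod (RtoC x - RtoC 0) < d).
    replace (RtoC x - RtoC 0)%C with (RtoC x) by ring; now rewrite Cmod_R. }
  specialize (Hd _ Hb); simpl in Hd.
  change (Cmod (phi x - phi 0 - (x - 0) * l) <= 1 * Cmod (x - 0)) in Hd.
  rewrite H0 in Hd.
  replace (phi x - 0 - (x - 0) * l)%C with (phi x - x * l)%C in Hd by ring.
  replace (x - 0)%C with (RtoC x) in Hd by ring.
  replace (phi x) with ((phi x - x * l) + x * l)%C by ring.
  eapply Rle_trans; [apply Cmod_triangle |].
  rewrite Cmod_mult; rewrite Cmod_R in *; lra.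
Qed.

(** * Complex derivatives of monomials *)

Lemma is_derive_Cpow (c : C) (n : nat) (z : C) :
  is_derive (K := C_AbsRing) (V := C_NormedModule)
    (fun x => c * Cpow x n)%C z (c * INR n * Cpow z (n - 1))%C.
Proof.
  (* The product rule lives on C as a module over itself. Both module structures carry the same
     norm, so the estimate transfers and only linearity is proved again. *)
  enough (H : is_derive (K := C_AbsRing) (V := AbsRing_NormedModule C_AbsRing)
                (fun x => c * Cpow x n)%C z (c * INR n * Cpow z (n - 1))%C)
    by (split; [apply is_linear_scal_l | exact (proj2 H)]).
  induction n as [|n IH].
  - replace (c * INR 0 * Cpow z (0 - 1))%C with (RtoC 0) by (simpl; ring).
    exact (is_derive_const (K := C_AbsRing) (V := AbsRing_NormedModule C_AbsRing)
             (c * 1)%C z).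
  - apply (is_derive_ext (fun x : C_AbsRing => mult x (c * Cpow x n)%C)).
    { intros x; change (x * (c * x ^ n) = c * (x * x ^ n))%C; ring. }
    refine (filterdiff_ext_lin _ _ _
      (filterdiff_mult_fct (K := C_AbsRing) (U := AbsRing_NormedModule C_AbsRing)
         (fun x => x) (fun x => c * Cpow x n)%C z _ _
         Cmult_comm (filterdiff_id _) IH) _); intros y.
    change ((y * (c * z ^ n) + z * (y * (c * INR n * z ^ (n - 1))))%C
            = y * (c * INR (S n) * z ^ (S n - 1)))%C.
    rewrite S_INR, RtoC_plus; replace (S n - 1)%nat with n by lia.
    (* z * z^(n-1) = z^n fails at n = 0, where n - 1 truncates; there the factor [INR n] is 0. *)
    destruct n as [|n]; [simpl; ring |].
    replace (S n - 1)%nat with n by lia; rewrite (Cpow_S z n); ring.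
Qed.

(** Pointwise equality with a monomial is assumed so that the rule applies directly to iterated
    derivatives. *)
Lemma C_derive_monomial (f : C -> C) (c : C) (n : nat) :
  (forall z, f z = (c * Cpow z n)%C) ->
  forall z, C_derive f z = (c * INR n * Cpow z (n - 1))%C.
Proof.
  intros Hf z; apply is_C_derive_unique.
  apply (is_derive_ext (K := C_AbsRing) (V := C_NormedModule) (fun x => c * Cpow x n)%C).
  - intros x; now rewrite Hf.
  - apply is_derive_Cpow.
Qed.

(** [d] is the falling factorial n (n-1) ... (n-m+1), of which only the vanishing matters. For n < m
    the truncated exponent is harmless, as d = 0. *)
Lemma iter_C_derive_pow (m n : nat) :
  exists d : C, (d = RtoC 0 <-> (n < m)%nat) /\
    forall z, Nat.iter m C_derive (fun x => Cpow x n) z = (d * Cpow z (n - m))%C.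
Proof.
  induction m as [|m (d & Hd & IH)].
  - exists (RtoC 1); split.
    + split; [intros H; now apply RtoC_inj, R1_neq_R0 in H | lia].
    + intros z; simpl; rewrite Nat.sub_0_r; ring.
  - exists (d * INR (n - m))%C; split.
    + split.
      * intros H; destruct (Nat.lt_ge_cases n (S m)) as [L|L]; [exact L | exfalso].
        apply (Cmult_neq_0 d (INR (n - m))); [| | exact H].
        -- intros E; apply Hd in E; lia.
        -- intros E; apply RtoC_inj in E; apply (not_0_INR (n - m)); [lia | exact E].
      * intros H; replace (n - m)%nat with 0%nat by lia; simpl; ring.
    + intros z; rewrite Nat.iter_succ, (C_derive_monomial _ _ _ IH).
      do 2 f_equal; lia.
Qed.

(** * Monomials in the weighted space *)

Lemma expands_on_disc_monomial (f : C -> C) (c : C) (n : nat) :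
  (forall z, f z = (c * Cpow z n)%C) ->
  expands_on_disc f (fun k => if Nat.eq_dec k n then c else RtoC 0).
Proof.
  intros Hf; apply expands_on_disc_series; intros z _.
  set (u := fun k => (z ^ k * (if Nat.eq_dec k n then c else 0))%C).
  assert (Hu : f z = u n).
  { unfold u; rewrite Hf; destruct (Nat.eq_dec n n); [ring | easy]. }
  assert (H0 : forall k, k <> n -> u k = RtoC 0).
  { intros k Hk; unfold u; destruct (Nat.eq_dec k n); [easy | ring]. }
  rewrite Hu; split.
  - apply (is_series_single (fun k => Re (u k))); intros k Hk; now rewrite (H0 k Hk).
  - apply (is_series_single (fun k => Im (u k))); intros k Hk; now rewrite (H0 k Hk).
Qed.

Lemma taylor_monomial (f : C -> C) (c : C) (n : nat) :
  (forall z, f z = (c * Cpow z n)%C) ->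
  forall k, taylor f k = if Nat.eq_dec k n then c else RtoC 0.
Proof.
  intros Hf; apply taylor_unique; now apply expands_on_disc_monomial.
Qed.

Lemma in_H2_monomial (beta : nat -> R) (f : C -> C) (c : C) (n : nat) :
  (forall z, f z = (c * Cpow z n)%C) -> in_H2 beta f.
Proof.
  intros Hf; split; [| split].
  - intros z _; eexists.
    apply (is_derive_ext (K := C_AbsRing) (V := C_NormedModule) (fun x => c * Cpow x n)%C).
    + intros x; now rewrite Hf.
    + apply is_derive_Cpow.
  - unfold taylor; apply epsilon_spec; eexists.
    now apply expands_on_disc_monomial with (c := c) (n := n).
  - eexists; apply is_series_single with (n := n).
    intros k Hk; rewrite (taylor_monomial f c n Hf).
    destruct (Nat.eq_dec k n); [easy |]; rewrite Cmod_0; ring.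
Qed.

(** * The conjugation [Jw] and inner products with monomials *)

Lemma Cconj_RtoC (x : R) : Cconj (RtoC x) = RtoC x.
Proof. unfold Cconj, RtoC; simpl; now rewrite Ropp_0. Qed.

Lemma Cconj_0_inv (c : C) : Cconj c = RtoC 0 -> c = RtoC 0.
Proof. intros H; now rewrite <- (Cconj_conj c), H, Cconj_RtoC. Qed.

(** Conjugate the expansion of [f] at w conj(z), a point of the disc since |w| = 1. *)
Lemma expands_on_disc_Jw (w : C) (f : C -> C) (a : nat -> C) :
  Cmod w = 1 -> expands_on_disc f a ->
  expands_on_disc (Jw w f) (fun k => Cconj (Cpow w k * a k)%C).
Proof.
  intros Hw Hf; apply expands_on_disc_series; intros z Hz.
  assert (Hwz : unit_disc (w * Cconj z)).
  { unfold unit_disc; now rewrite Cmod_mult, Hw, Cmod_conj, Rmult_1_l. }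
  destruct (proj1 (expands_on_disc_series f a) Hf _ Hwz) as [H1 H2].
  assert (E : forall k, (z ^ k * Cconj (w ^ k * a k))%C
                        = Cconj ((w * Cconj z) ^ k * a k)).
  { intros k; rewrite Cpow_mult_l, !Cmult_conj, !Cpow_conj, Cconj_conj; ring. }
  unfold Jw; rewrite re_conj, im_conj; split.
  - apply is_series_ext with (2 := H1); intros k; now rewrite E, re_conj.
  - apply is_series_opp in H2.
    apply is_series_ext with (2 := H2); intros k; now rewrite E, im_conj.
Qed.

Lemma H2_inner_pow_l (beta : nat -> R) (g : C -> C) (n : nat) :
  H2_inner beta (fun z => Cpow z n) g = (Cconj (taylor g n) * RtoC (beta n ^ 2))%C.
Proof.
  unfold H2_inner.
  assert (Ht := taylor_monomial (fun z => Cpow z n) 1 n (fun z => eq_sym (Cmult_1_l _))).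
  rewrite (C_Series_single _ n).
  - rewrite Ht; destruct (Nat.eq_dec n n); [ring | easy].
  - intros k Hk; rewrite Ht; destruct (Nat.eq_dec k n); [easy | ring].
Qed.

Lemma H2_inner_supported_r (beta : nat -> R) (f g : C -> C) (n : nat) :
  (forall k, k <> n -> taylor g k = RtoC 0) ->
  H2_inner beta f g = (taylor f n * Cconj (taylor g n) * RtoC (beta n ^ 2))%C.
Proof.
  intros Hg; unfold H2_inner; rewrite (C_Series_single _ n); [reflexivity |].
  intros k Hk; rewrite (Hg k Hk), Cconj_RtoC; ring.
Qed.

Lemma Jw_pow (w : C) (n : nat) (z : C) :
  Jw w (fun x => Cpow x n) z = (Cconj (Cpow w n) * Cpow z n)%C.
Proof. unfold Jw; now rewrite Cpow_mult_l, Cmult_conj, !Cpow_conj, Cconj_conj. Qed.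

Lemma pow_in_H2 (beta : nat -> R) (n : nat) : in_H2 beta (fun z => Cpow z n).
Proof. apply in_H2_monomial with (c := RtoC 1) (n := n); intros z; ring. Qed.

Lemma weight_cancel (r : R) (a b : C) :
  0 < r -> (a * RtoC (r ^ 2))%C = (b * RtoC (r ^ 2))%C -> a = b.
Proof.
  intros Hr H.
  assert (Hr2 : RtoC (r ^ 2) <> RtoC 0).
  { intros E; apply RtoC_inj in E; revert E.
    now apply Rgt_not_eq, pow_lt. }
  replace a with (a * RtoC (r ^ 2) / RtoC (r ^ 2))%C by (field; exact Hr2).
  rewrite H; field; exact Hr2.
Qed.

(** * Matrix entries, symmetry of the zero pattern, diagonal operators *)

(** Row [k], column [n] of the matrix of [T] in the monomials, which are orthogonal with z^n of norm
    [beta n]. *)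
Definition mat_coef (T : (C -> C) -> (C -> C)) (k n : nat) : C :=
  taylor (T (fun z => Cpow z n)) k.

(** The relation behind this is t(k,n) = conj(w)^k w^n (beta n / beta k)^2 t(n,k). *)
Lemma J_symmetric_zero_pattern (beta : nat -> R) (w : C) (T S : (C -> C) -> (C -> C)) :
  (forall n, 0 < beta n) ->
  (forall f, in_H2 beta f -> in_H2 beta (T f)) ->
  is_adjoint beta T S ->
  Cmod w = 1 ->
  (forall f, in_H2 beta f ->
     forall z, unit_disc z -> T f z = Jw w (S (Jw w f)) z) ->
  forall k n, mat_coef T n k = RtoC 0 -> mat_coef T k n = RtoC 0.
Proof.
  intros Hbeta T_H2 adj Hw Hsym k n H0; unfold mat_coef in *.
  set (en := fun z => Cpow z n); set (g := Jw w en).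
  assert (Hg : in_H2 beta g).
  { apply in_H2_monomial with (c := Cconj (Cpow w n)) (n := n); apply Jw_pow. }
  destruct (proj1 adj g Hg) as (_ & HSg & _).
  rewrite (expands_on_disc_unique (T en) (Jw w (S g)) _
             (fun k => Cconj (Cpow w k * taylor (S g) k)%C)).
  (* Pairing T z^k with [g], a multiple of z^n, shows t(n,k) on one side and the k-th coefficient of
     [S g] on the other. *)
  - generalize (proj2 adj _ g (pow_in_H2 beta k) Hg); intros E.
    rewrite H2_inner_pow_l, (H2_inner_supported_r _ _ _ n), H0, !Cmult_0_l in E.
    + replace (taylor (S g) k) with (RtoC 0); [rewrite Cmult_0_r; apply Cconj_RtoC |].
      symmetry; apply Cconj_0_inv, weight_cancel with (beta k); [apply Hbeta |].
      rewrite <- E; ring.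
    + intros j Hj; unfold g; rewrite (taylor_monomial _ _ n (Jw_pow w n)).
      now destruct (Nat.eq_dec j n).
  - apply (T_H2 en (pow_in_H2 beta n)).
  - now apply expands_on_disc_Jw.
  - intros z Hz; now apply Hsym; [apply pow_in_H2 |].
Qed.

(** On k-th coefficients [T] multiplies by d = t(k,k) and [S] by conj(d), so both compositions
    multiply by |d|^2. *)
Lemma diagonal_normal (beta : nat -> R) (T S : (C -> C) -> (C -> C)) :
  (forall n, 0 < beta n) ->
  (forall f, in_H2 beta f -> in_H2 beta (T f)) ->
  is_adjoint beta T S ->
  (forall k n, k <> n -> mat_coef T k n = RtoC 0) -> normal_on_H2 beta T.
Proof.
  intros Hbeta T_H2 adj Hdiag; exists S; split; [exact adj |].
  destruct adj as [S_H2 Hadj].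
  assert (HS : forall g k, in_H2 beta g ->
    taylor (S g) k = (Cconj (mat_coef T k k) * taylor g k)%C).
  { intros g k Hg.
    generalize (Hadj _ g (pow_in_H2 beta k) Hg); intros E.
    rewrite H2_inner_pow_l in E.
    assert (E' : H2_inner beta (T (fun z => Cpow z k)) g
                 = (mat_coef T k k * Cconj (taylor g k) * RtoC (beta k ^ 2))%C).
    { unfold H2_inner; rewrite (C_Series_single _ k); [reflexivity |].
      intros j Hj; unfold mat_coef in Hdiag; rewrite (Hdiag j k Hj); ring. }
    rewrite E' in E; apply weight_cancel in E; [| apply Hbeta].
    rewrite <- (Cconj_conj (taylor (S g) k)), <- E, Cmult_conj, Cconj_conj; reflexivity. }
  (* Diagonality speaks of monomials only; the adjoint relation tested against z^k, with the formula
     for S z^k, extends it to every [f]. *)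
  assert (HT : forall f k, in_H2 beta f -> taylor (T f) k = (mat_coef T k k * taylor f k)%C).
  { intros f k Hf.
    generalize (Hadj f _ Hf (pow_in_H2 beta k)); intros E.
    assert (Ht := taylor_monomial (fun z => Cpow z k) 1 k (fun z => eq_sym (Cmult_1_l _))).
    rewrite !(H2_inner_supported_r _ _ _ k) in E.
    - apply weight_cancel in E; [| apply Hbeta].
      rewrite (HS _ _ (pow_in_H2 beta k)), Ht in E.
      destruct (Nat.eq_dec k k) as [_|]; [| easy].
      rewrite Cmult_conj, Cconj_conj, Cconj_RtoC in E.
      rewrite !Cmult_1_r in E; rewrite E; ring.
    - intros j Hj; rewrite (HS _ _ (pow_in_H2 beta k)), Ht.
      destruct (Nat.eq_dec j k); [easy | ring].
    - intros j Hj; rewrite Ht; now destruct (Nat.eq_dec j k). }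
  intros f Hf.
  apply (expands_on_disc_eq _ _ (taylor (T (S f))) (taylor (S (T f)))).
  - apply (T_H2 _ (S_H2 _ Hf)).
  - apply (S_H2 _ (T_H2 _ Hf)).
  - intros k; rewrite HT, HS, HS, HT by auto; ring.
Qed.

(** * Triangularity of the matrix of the weighted composition operator *)

Theorem theorem4 :
  forall (beta : nat -> R) (w : C) (m : nat) (phi psi : C -> C),
    weight_sequence beta ->
    Cmod w = 1%R ->
    analytic_self_map phi ->
    phi (RtoC 0) = RtoC 0 ->
    analytic_on_disc psi ->
    (exists z : C, unit_disc z /\ psi z <> RtoC 0) ->
    bounded_on_H2 beta (gen_wcomp m psi phi) ->
    J_symmetric beta w (gen_wcomp m psi phi) ->
    normal_on_H2 beta (gen_wcomp m psi phi).
Proof.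
  intros beta w m phi psi [Hbeta _] Hw [Hphi _] Hphi0 _ _ [HT _] (S & Hadj & Hsym).
  assert (HS := J_symmetric_zero_pattern beta w _ S Hbeta HT Hadj Hw Hsym).
  set (T := gen_wcomp m psi phi) in *.
  assert (Hpow : forall n, exists d, (d = RtoC 0 <-> (n < m)%nat) /\
    forall z, T (fun x => Cpow x n) z = (d * (psi z * Cpow (phi z) (n - m)))%C).
  { intros n; destruct (iter_C_derive_pow m n) as (d & Hd & H).
    exists d; split; [exact Hd |].
    intros z; unfold T, gen_wcomp; rewrite H; ring. }
  assert (Hcoef : forall k n, (k < n)%nat -> order_ge n (T (fun x => Cpow x n)) ->
    taylor (T (fun x => Cpow x n)) k = RtoC 0).
  { intros k n Hk H; apply (order_ge_taylor _ _ n) with (2 := H); [| exact Hk].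
    apply (HT _ (pow_in_H2 beta n)). }
  assert (Hlow : forall k n, (n < m)%nat -> taylor (T (fun x => Cpow x n)) k = RtoC 0).
  { intros k n Hn; destruct (Hpow n) as (d & Hd & E).
    (* The zero function is treated as the monomial 0 * z^0. *)
    rewrite (taylor_monomial _ 0 0).
    - now destruct (Nat.eq_dec k 0).
    - intros z; rewrite E, (proj2 Hd Hn); ring. }
  (* T z^m is a nonzero multiple of psi, and its first m coefficients vanish by symmetry. *)
  assert (Hpsi : order_ge m psi).
  { destruct (Hpow m) as (d & Hd & E).
    assert (Hd0 : d <> RtoC 0) by (intros H; apply Hd in H; lia).
    assert (H : order_ge m (T (fun x => Cpow x m))).
    { apply taylor_order_ge with (taylor (T (fun x => Cpow x m))).
      - apply (HT _ (pow_in_H2 beta m)).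
      - intros k Hk; now apply HS, Hlow. }
    (* Multiplication by the constant 1/d, of order 0, recovers [psi]. *)
    apply (order_ge_mult 0 m _ _ (order_ge_const (/ d))) in H.
    destruct H as (e & M & He & H); exists e, M; split; [exact He |].
    intros x Hx; specialize (H x Hx); rewrite E, Nat.sub_diag in H.
    replace (/ d * (d * (psi x * phi x ^ 0)))%C with (psi x) in H
      by (simpl; field; exact Hd0).
    exact H. }
  assert (Hlt : forall k n, (k < n)%nat -> taylor (T (fun x => Cpow x n)) k = RtoC 0).
  { intros k n Hk; destruct (Nat.lt_ge_cases n m) as [Hn|Hn]; [now apply Hlow |].
    apply Hcoef; [exact Hk |].
    destruct (Hpow n) as (d & _ & E).
    (* The constant contributes order 0, [psi] order m and the power of [phi] order n - m; the total
       is n because m <= n. *)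
    assert (H : order_ge (0 + (m + (n - m)))
                  (fun z => d * (psi z * Cpow (phi z) (n - m)))%C).
    { apply (order_ge_mult 0 _ _ _ (order_ge_const d)).
      apply order_ge_mult; [exact Hpsi | now apply order_ge_pow, order_ge_fixed_0]. }
    replace (0 + (m + (n - m)))%nat with n in H by lia.
    destruct H as (e & M & He & H); exists e, M; split; [exact He |].
    intros x Hx; rewrite E; now apply H. }
  apply (diagonal_normal beta T S Hbeta HT Hadj).
  intros k n Hkn; destruct (Nat.lt_gt_cases k n) as [Hc _].
  (* Entries with k < n vanish by triangularity, those with k > n by the symmetric zero pattern. *)
  destruct (Hc Hkn) as [H|H]; [now apply Hlt | now apply HS, Hlt].
Qed.
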